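(* There is an absolute constant $C>0$ such that for every $\epsilon>0$ and positive integer $m$, with $M=m^{C}\epsilon^{-C\epsilon^{-5}}$, the following holds: for every $n\in\mathbb{N}$ and every $n\times n$ matrix $Y=(y_{ij})$ with entries in $[0,1]$, there is an integer $k\in[m,M]$ such that every equipartition of $[n]$ into $k$ intervals is interval $\epsilon$-regular for $Y$.
   Context: An interval is a subset of $[n]$ of consecutive integers. For intervals $I,J\subseteq[n]$, $d_Y(I,J)=\frac{1}{|I||J|}\sum_{i\in I,j\in J}y_{ij}$. A pair of intervals $(I,J)$ is interval $\epsilon$-regular for $Y$ if for all subintervals $A\subseteq I$, $B\subseteq J$ with $|A|\ge\epsilon|I|$ and $|B|\ge\epsilon|J|$, $|d_Y(A,B)-d_Y(I,J)|\le\epsilon$. A partition $\mathcal{P}$ of $[n]$ into $k$ intervals is interval $\epsilon$-regular for $Y$ if all except at most $\epsilon k^2$ pairs $(I,J)$ of intervals of $\mathcal{P}$ are interval $\epsilon$-regular for $Y$. An equipartition is a partition in which every two parts differ in size by at most one.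
   Formalization: The case m = 1 with ε > 1 is excluded, because there M = ε^{-Cε^{-5}} < 1 for every C > 0, so no integer k lies in [m, M] and the claim as written fails. *)

(* Defs.v *)
From HB Require Import structures.
From mathcomp Require Import all_boot all_order all_algebra.
From mathcomp Require Import reals exp.
Set Implicit Arguments.
Unset Strict Implicit.
Unset Printing Implicit Defensive.
Import Order.TTheory GRing.Theory Num.Theory.
Local Open Scope ring_scope.

(* [n] is 'I_n, i.e. {0, ..., n-1}; a set of consecutive integers is written
   as {a, ..., b-1} with 0 <= a, b <= n (the empty set is a = b). *)
Definition is_ord_interval (n : nat) (A : {set 'I_n}) : bool :=
  [exists a : 'I_n.+1, exists b : 'I_n.+1,
     A == [set i : 'I_n | (a <= i)%N && (i < b)%N]%SET].

Section Regularity.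
Variables (R : realType) (n : nat).
Implicit Types (Y : 'M[R]_n) (I J A B : {set 'I_n}) (P : {set {set 'I_n}}).

Definition density Y I J : R :=
  (\sum_(i in I) \sum_(j in J) Y i j) / (#|I|%:R * #|J|%:R).

Definition interval_regular_pair (eps : R) Y I J : bool :=
  [forall A : {set 'I_n}, forall B : {set 'I_n},
     [&& is_ord_interval A, is_ord_interval B, A \subset I, B \subset J,
         eps * #|I|%:R <= #|A|%:R & eps * #|J|%:R <= #|B|%:R] ==>
     (`|density Y A B - density Y I J| <= eps)].

(* The k ^ 2 pairs are the ordered ones, I = J included. *)
Definition interval_regular_partition (eps : R) Y P : Prop :=
  #|[set p in finset.setX P P | ~~ interval_regular_pair eps Y p.1 p.2]%SET|%:R
    <= eps * #|P|%:R ^+ 2.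

(* [finset.partition] requires the parts to be nonempty. *)
Definition interval_equipartition P : Prop :=
  [/\ finset.partition P [set: 'I_n]%SET,
      {in P, forall I, is_ord_interval I}
    & {in P &, forall I J, (#|I| <= #|J|.+1)%N}].

End Regularity.

(* Main.v *)
Require Import Defs.
From HB Require Import structures.
From mathcomp Require Import all_boot all_order all_algebra.
From mathcomp Require Import reals exp.
From mathcomp Require Import ring lra zify.
Set Implicit Arguments.
Unset Strict Implicit.
Unset Printing Implicit Defensive.
Import Order.TTheory GRing.Theory Num.Theory.
Local Open Scope ring_scope.

(* Cut [n] at the points floor(a n / k); the resulting blocks of level k t refine
   those of level k. The energy of level k is the sum of the squares of Y averaged
   over pairs of blocks. Along m, m t, m t^2, ... it increases and stays below n^2,
   so one of the first ~32 / eps^5 steps gains at most (eps^5 / 32) n^2, and that level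
   works when t ~ 64 / eps^2. Indeed the part of rank a of any equipartition into k
   intervals differs from the a-th block in at most 2k points, and an interval
   witnessing irregularity contains, up to a small proportion, a union of blocks of
   level k t. By Cauchy-Schwarz each irregular pair therefore contributes at least
   (eps^4 / 8) floor(n / k)^2 to the energy gained from k to k t, and more than
   eps k^2 irregular pairs contribute too much. This requires n to be large compared
   with the levels; otherwise take k > n, for which there is no equipartition. When
   eps >= 2/3 every pair is regular, as the two densities differ by at most
   2 (1 - eps). *)

Section Fibers.
Variables (T : finType) (L : eqType).
Implicit Types (b : T -> L) (v : L) (X : {set T}).

Definition factors_through S b (h : T -> S) : Prop :=
  forall x y, b x = b y -> h x = h y.

Definition saturated b X : Prop := factors_through b (fun x => x \in X).

Definition fiber b v : {set T} := [set x | b x == v].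

Definition saturated_core b X : {set T} := [set x | fiber b (b x) \subset X].

Lemma mem_fiber b x : x \in fiber b (b x).
Proof. by rewrite inE. Qed.

Lemma saturated_core_sub b X : saturated_core b X \subset X.
Proof. by apply/subsetP=> x; rewrite inE => /subsetP; apply; apply: mem_fiber. Qed.

Lemma saturated_core_saturated b X : saturated b (saturated_core b X).
Proof. by move=> x y bxy; rewrite !inE bxy. Qed.

Lemma ler_sum_fibers (R : numDomainType) (I : finType) (A : {set I})
    (phi : I -> L) b (g : T -> R) :
    {in A &, injective phi} -> (forall x, 0 <= g x) ->
  \sum_(i in A) \sum_(x in fiber b (phi i)) g x <= \sum_x g x.
Proof.
move=> phi_inj g_ge0; rewrite (exchange_big_dep xpredT) //=.
apply: ler_sum => x _; rewrite sumr_const -mulr_natr ler_piMr // (ler_nat _ _ 1).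
apply/card_le1_eqP=> i j /andP[iA]; rewrite inE => /eqP b_i.
by case/andP=> jA; rewrite inE => /eqP b_j; apply: phi_inj; rewrite -?b_i.
Qed.

End Fibers.

Lemma saturated_setX (T U : finType) (L M : eqType) (b : T -> L) (c : U -> M)
    (X : {set T}) (Z : {set U}) :
  saturated b X -> saturated c Z ->
  saturated (fun p => (b p.1, c p.2)) (setX X Z).
Proof. by move=> satX satZ [x z] [y w] [/satX eX /satZ eZ]; rewrite !in_setX eX eZ. Qed.

Section Means.
Variables (R : realFieldType) (T : finType).
Implicit Types (F : T -> R) (X Z : {set T}).

Definition mean F X : R := (\sum_(x in X) F x) / #|X|%:R.

Definition missing_ratio X Z : R := #|Z :\: X|%:R / #|Z|%:R.

Lemma mulr_mean F X : mean F X * #|X|%:R = \sum_(x in X) F x.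
Proof.
have [->|X0] := eqVneq X set0; first by rewrite cards0 mulr0 big_set0.
by rewrite /mean divfK // pnatr_eq0 cards_eq0.
Qed.

Lemma natr_card_subset X Z :
  X \subset Z -> #|Z|%:R = #|X|%:R + #|Z :\: X|%:R :> R.
Proof. by move=> XZ; rewrite -natrD -(cardsID X Z) (setIidPr XZ). Qed.

Lemma missing_ratio_ge0 X Z : 0 <= missing_ratio X Z.
Proof. by rewrite divr_ge0. Qed.

Lemma missing_ratio_le X Z (r : R) :
  0 <= r -> #|Z :\: X|%:R <= r * #|Z|%:R -> missing_ratio X Z <= r.
Proof.
move=> r_ge0 XZ; have [Z0|Z0] := eqVneq Z set0.
  by rewrite /missing_ratio Z0 cards0 invr0 mulr0.
by rewrite ler_pdivrMr // ltr0n card_gt0.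
Qed.

Lemma card_missing_ratio X Z :
  X \subset Z -> #|X|%:R = (1 - missing_ratio X Z) * #|Z|%:R.
Proof.
move=> XZ; suff missing : missing_ratio X Z * #|Z|%:R = #|Z :\: X|%:R.
  by rewrite mulrBl mul1r missing (natr_card_subset XZ) addrK.
have [->|Z0] := eqVneq Z set0; first by rewrite set0D cards0 mulr0.
by rewrite divfK // pnatr_eq0 cards_eq0.
Qed.

Lemma mean_sqr_le F X : #|X|%:R * mean F X ^+ 2 <= \sum_(x in X) F x ^+ 2.
Proof.
have : 0 <= \sum_(x in X) (F x - mean F X) ^+ 2.
  by apply: sumr_ge0 => x _; exact: sqr_ge0.
suff -> : \sum_(x in X) (F x - mean F X) ^+ 2 =
    \sum_(x in X) F x ^+ 2 - #|X|%:R * mean F X ^+ 2 by rewrite subr_ge0.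
transitivity (\sum_(x in X) F x ^+ 2 - mean F X *+ 2 * (\sum_(x in X) F x)
    + \sum_(x in X) mean F X ^+ 2).
  by rewrite mulr_sumr -sumrB -big_split; apply: eq_bigr => x _ /=; ring.
by rewrite sumr_const -mulr_mean; ring.
Qed.

Section UnitInterval.
Variable F : T -> R.
Hypothesis F01 : forall x, 0 <= F x <= 1.

Lemma sum_itv01 X : 0 <= \sum_(x in X) F x <= #|X|%:R.
Proof.
rewrite sumr_ge0 /=; last by move=> x _; case/andP: (F01 x).
by rewrite -sum1_card natr_sum; apply: ler_sum => x _; case/andP: (F01 x).
Qed.

Lemma mean_itv01 X : 0 <= mean F X <= 1.
Proof.
have /andP[S_ge0 S_le] := sum_itv01 X; rewrite divr_ge0 //=.
have [->|X0] := eqVneq X set0; first by rewrite /mean cards0 invr0 mulr0.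
by rewrite ler_pdivrMr ?mul1r // ltr0n card_gt0.
Qed.

Lemma mean_subset X Z :
  X \subset Z -> `|mean F X - mean F Z| <= missing_ratio X Z.
Proof.
move=> XZ; have [Z0|Z0] := eqVneq Z set0.
  by move: XZ; rewrite Z0 subset0 => /eqP->; rewrite subrr normr0 missing_ratio_ge0.
have cZ : 0 < #|Z|%:R :> R by rewrite ltr0n card_gt0.
have sumZ : \sum_(x in Z) F x = \sum_(x in X) F x + \sum_(x in Z :\: X) F x.
  by rewrite (big_setID X) /= (setIidPr XZ).
have -> : mean F X - mean F Z =
    (mean F X * #|Z :\: X|%:R - \sum_(x in Z :\: X) F x) / #|Z|%:R.
  apply: (mulIf (lt0r_neq0 cZ)); rewrite divfK ?lt0r_neq0 // mulrBl mulr_mean sumZ.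
  by rewrite -mulr_mean (natr_card_subset XZ); ring.
rewrite normrM normfV (gtr0_norm cZ) ler_pM2r ?invr_gt0 //.
have /andP[? ?] := mean_itv01 X; have /andP[? ?] := sum_itv01 (Z :\: X).
have : 0 <= mean F X * #|Z :\: X|%:R <= #|Z :\: X|%:R.
  by rewrite mulr_ge0 //= ler_piMl.
by rewrite ler_norml; lra.
Qed.

End UnitInterval.
End Means.

Lemma missing_ratio_setX (R : realFieldType) (T U : finType)
    (A I : {set T}) (B J : {set U}) :
  missing_ratio R (setX A B) (setX I J) <= missing_ratio R A I + missing_ratio R B J.
Proof.
have sum_ge0 := addr_ge0 (missing_ratio_ge0 R A I) (missing_ratio_ge0 R B J).
have [I0|I0] := eqVneq I set0.
  by rewrite {1}/missing_ratio cardsX {2}I0 cards0 mul0n invr0 mulr0.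
have [J0|J0] := eqVneq J set0.
  by rewrite {1}/missing_ratio cardsX {2}J0 cards0 muln0 invr0 mulr0.
have cI : #|I|%:R != 0 :> R by rewrite pnatr_eq0 cards_eq0.
have cJ : #|J|%:R != 0 :> R by rewrite pnatr_eq0 cards_eq0.
have -> : missing_ratio R A I + missing_ratio R B J =
    (#|setX (I :\: A) J| + #|setX I (J :\: B)|)%:R / #|setX I J|%:R.
  by rewrite /missing_ratio !cardsX natrD !natrM; field; rewrite cI cJ.
rewrite ler_wpM2r ?invr_ge0 // ler_nat; apply: leq_trans (leq_card_setU _ _).
apply/subset_leq_card/subsetP=> p; rewrite !inE negb_and.
by case/andP=> /orP[->|->] /andP[-> ->]; rewrite ?orbT.
Qed.

Section ClassMeans.
Variables (R : realFieldType) (T : finType).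
Implicit Types (F h : T -> R) (X Z : {set T}) (L : eqType).

Definition class_mean L (b : T -> L) F x : R := mean F (fiber b (b x)).

Definition energy L (b : T -> L) F : R := \sum_x class_mean b F x ^+ 2.

Lemma class_mean_factors L (b : T -> L) F : factors_through b (class_mean b F).
Proof. by move=> x y bxy; rewrite /class_mean bxy. Qed.

Lemma energy_bounds L (b : T -> L) F :
  (forall x, 0 <= F x <= 1) -> 0 <= energy b F <= #|T|%:R.
Proof.
move=> F01; have sqr01 x : 0 <= class_mean b F x ^+ 2 <= 1.
  by have /andP[? ?] := mean_itv01 F01 (fiber b (b x)); rewrite sqr_ge0 expr_le1.
by have := sum_itv01 sqr01 [set: T]; rewrite cardsT; under eq_bigl do rewrite inE.
Qed.

(* [class_mean b] is the orthogonal projection onto the functions that factor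
   through [b]. *)
Lemma sum_mul_class_mean L (b : T -> L) F h :
  factors_through b h -> \sum_x h x * class_mean b F x = \sum_x h x * F x.
Proof.
move=> hb; pose N x : R := #|fiber b (b x)|%:R.
have -> : \sum_x h x * class_mean b F x =
    \sum_x \sum_(y | b x == b y) h y * F y / N y.
  apply: eq_bigr => x _; rewrite /class_mean /mean mulrA mulr_sumr mulr_suml.
  apply: eq_big => [y|y]; first by rewrite inE eq_sym.
  by rewrite inE => /eqP byx; rewrite /N byx (hb _ _ byx).
rewrite (exchange_big_dep xpredT) //=; apply: eq_bigr => y _.
rewrite sumr_const -cardsE -/(fiber b (b y)) -/(N y) -mulr_natr divfK //.
by rewrite pnatr_eq0 cards_eq0; apply/set0Pn; exists y; exact: mem_fiber.
Qed.

Lemma mean_class_mean L (b : T -> L) F X :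
  saturated b X -> mean (class_mean b F) X = mean F X.
Proof.
move=> satX; have indic (f : T -> R) : \sum_(x in X) f x = \sum_x (x \in X)%:R * f x.
  by rewrite big_mkcond; apply: eq_bigr => x _; case: ifP; rewrite ?mul1r ?mul0r.
by rewrite /mean !indic sum_mul_class_mean // => x y /satX->.
Qed.

Lemma energy_refine L1 L2 (b : T -> L1) (c : T -> L2) F : factors_through c b ->
  energy c F - energy b F = \sum_x (class_mean c F x - class_mean b F x) ^+ 2.
Proof.
move=> cb; have cross : \sum_x class_mean b F x * class_mean c F x = energy b F.
  rewrite sum_mul_class_mean => [|x y /cb]; last exact: class_mean_factors.
  by rewrite -(sum_mul_class_mean _ (@class_mean_factors _ b F)).
transitivity (energy c F + energy b F
    - (\sum_x class_mean b F x * class_mean c F x) *+ 2).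
  by rewrite cross; ring.
rewrite /energy -sumrMnl -big_split -sumrB /=.
by apply: eq_bigr => x _; ring.
Qed.

Lemma fiber_energy_gain L1 L2 (b : T -> L1) (c : T -> L2) F X v :
  X \subset fiber b v -> saturated c X ->
  #|X|%:R * (mean F X - mean F (fiber b v)) ^+ 2 <=
    \sum_(x in fiber b v) (class_mean c F x - class_mean b F x) ^+ 2.
Proof.
move=> Xv satX; pose g x := class_mean c F x - class_mean b F x.
apply: (@le_trans _ _ (\sum_(x in X) g x ^+ 2)); last first.
  rewrite [leRHS](big_setID X) /= (setIidPr Xv) lerDl.
  by apply: sumr_ge0 => x _; exact: sqr_ge0.
have [->|X0] := eqVneq X set0; first by rewrite cards0 mul0r big_set0.
suff -> : mean F X - mean F (fiber b v) = mean g X by exact: mean_sqr_le.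
have mean_b : mean (class_mean b F) X = mean F (fiber b v).
  rewrite [LHS]/mean (eq_bigr (fun=> mean F (fiber b v))) => [|x /(subsetP Xv)].
    by rewrite sumr_const -(mulr_natr (mean _ _)) mulfK // pnatr_eq0 cards_eq0.
  by rewrite inE /class_mean => /eqP->.
by rewrite -mean_b -(mean_class_mean _ satX) -mulrBl -sumrB.
Qed.

End ClassMeans.

Section OrdIntervals.
Variable n : nat.
Implicit Types (A I J : {set 'I_n}) (P : {set {set 'I_n}}).

Definition ord_itv (a b : nat) : {set 'I_n} := [set i : 'I_n | a <= i < b]%N.

Lemma card_ord_itv a b : #|ord_itv a b| = (minn b n - a)%N.
Proof.
rewrite -sum1dep_card -[RHS]muln1 -sum_nat_const_nat.
rewrite (big_nat_widen _ _ n) ?geq_minr // big_geq_mkord.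
by apply: eq_bigl => i /=; have := ltn_ord i; lia.
Qed.

Lemma ord_intervalP A :
  reflect (exists a b, A = ord_itv a b) (is_ord_interval A).
Proof.
apply: (iffP existsP) => [[a /existsP[b /eqP->]]|[a [b ->]]]; first by exists a, b.
have min_lt c : (minn c n < n.+1)%N by rewrite ltnS geq_minr.
exists (Ordinal (min_lt a)); apply/existsP; exists (Ordinal (min_lt b)).
apply/eqP/setP=> i; rewrite !inE /=; have := ltn_ord i; lia.
Qed.

Lemma ord_itvI a b c d :
  ord_itv a b :&: ord_itv c d = ord_itv (maxn a c) (minn b d).
Proof. by apply/setP=> i; rewrite !inE geq_max leq_min; lia. Qed.

Lemma is_ord_intervalI A B :
  is_ord_interval A -> is_ord_interval B -> is_ord_interval (A :&: B).
Proof.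
move=> /ord_intervalP[a [b ->]] /ord_intervalP[c [d ->]].
by apply/ord_intervalP; rewrite ord_itvI; eexists; eexists.
Qed.

Lemma card_ord_itvD a b c d :
  (#|ord_itv a b :\: ord_itv c d| <= (c - a) + (b - d))%N.
Proof.
apply: (@leq_trans #|ord_itv a c :|: ord_itv d b|).
  by apply/subset_leq_card/subsetP=> i; rewrite !inE; lia.
apply: leq_trans (leq_card_setU _ _) _; rewrite !card_ord_itv.
by rewrite leq_add ?leq_sub2r ?geq_minl.
Qed.

Definition below A : {set 'I_n} := [set i : 'I_n | [forall j in A, (i < j)%N]].

Lemma belowP A (i : 'I_n) : reflect {in A, forall j : 'I_n, (i < j)%N} (i \in below A).
Proof. by rewrite inE; apply: forall_inP. Qed.

Lemma below_subset I J : I != set0 -> I \subset below J -> below I \subset below J.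
Proof.
case/set0Pn=> x xI IJ; apply/subsetP=> i /belowP/(_ x xI) ix.
by apply/belowP=> j jJ; apply: ltn_trans ix _; exact: (belowP _ _ (subsetP IJ _ xI)).
Qed.

Lemma ord_interval_neq0P A : is_ord_interval A -> A != set0 ->
  exists u v, [/\ (u < v <= n)%N, A = ord_itv u v & below A = ord_itv 0 u].
Proof.
move=> /ord_intervalP[u [v AE]]; rewrite AE => /set0Pn[x].
rewrite inE => /andP[ux xv]; have xn := ltn_ord x.
exists u, (minn v n); split; first by lia.
  by apply/setP=> i; rewrite !inE; have := ltn_ord i; lia.
apply/setP=> i; rewrite [RHS]inE; apply/belowP/idP => [lt_i|iu j].
  by apply: (lt_i (Ordinal (leq_ltn_trans ux xn))); rewrite inE /= leqnn; lia.
by rewrite inE; lia.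
Qed.

Lemma disjoint_ord_itv u v c d : (u < v <= n)%N -> (c < d <= n)%N ->
  [disjoint ord_itv u v & ord_itv c d] -> (v <= c)%N || (d <= u)%N.
Proof.
move=> uv cd /pred0P dis; apply: contraT => meet.
have max_lt : (maxn u c < n)%N by lia.
by have := dis (Ordinal max_lt); rewrite /= !inE /=; lia.
Qed.

Lemma disjoint_sub_below I J :
    is_ord_interval I -> is_ord_interval J -> I != set0 -> J != set0 ->
  [disjoint I & J] -> (I \subset below J) || (J \subset below I).
Proof.
move=> intI intJ /(ord_interval_neq0P intI)[u [v [uv -> ->]]].
move=> /(ord_interval_neq0P intJ)[c [d [cd -> ->]]].
case/(disjoint_ord_itv uv cd)/orP=> le_end; apply/orP; [left|right];
  by apply/subsetP=> i; rewrite !inE; lia.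
Qed.

Definition part_rank P I : nat := #|P ::&: below I|.

Section IntervalPartition.
Variable P : {set {set 'I_n}}.
Hypothesis partP : partition P [set: 'I_n].
Hypothesis intP : {in P, forall I, is_ord_interval I}.

Lemma part_neq0 I : I \in P -> I != set0.
Proof. by apply: contraTneq => ->; rewrite (partition0 partP). Qed.

Lemma card_partition_le : (#|P| <= n)%N.
Proof.
rewrite -[leqRHS]card_ord -cardsT (card_partition partP) -sum1_card.
by apply: leq_sum => I /part_neq0; rewrite card_gt0.
Qed.

Lemma parts_sub_below : {in P &, forall I J,
  I != J -> (I \subset below J) || (J \subset below I)}.
Proof.
move=> I J IP JP IJ; apply: disjoint_sub_below; rewrite ?intP ?part_neq0 //.
by have /trivIsetP := partition_trivIset partP; apply.
Qed.

Lemma cover_below I : I \in P -> cover (P ::&: below I) = below I.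
Proof.
move=> IP; apply/eqP; rewrite eqEsubset (subset_trans (cover_setI _ _)) ?subsetIr //=.
apply/subsetP=> i i_below.
have /bigcupP[J JP iJ] : i \in cover P by rewrite (cover_partition partP).
apply/bigcupP; exists J => //; rewrite inE JP /=.
have [x xI] := set0Pn _ (part_neq0 IP).
have i_lt := belowP _ _ i_below.
have IJ : I != J by apply: contraTneq iJ => <-; apply/negP=> /i_lt; rewrite ltnn.
have /orP[/subsetP/(_ x xI)/belowP/(_ i iJ)|//] := parts_sub_below IP JP IJ.
by rewrite ltnNge (ltnW (i_lt x xI)).
Qed.

Lemma card_below I : I \in P -> #|below I| = (\sum_(J in P ::&: below I) #|J|)%N.
Proof.
move=> IP; rewrite -[in LHS](cover_below IP).
by rewrite (eqP (trivIsetI _ (partition_trivIset partP))).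
Qed.

Lemma part_notin_below I : I \in P -> I \notin P ::&: below I.
Proof.
move=> IP; have [x xI] := set0Pn _ (part_neq0 IP).
rewrite inE IP /=; apply/subsetPn; exists x => //.
by apply/belowP=> /(_ x xI); rewrite ltnn.
Qed.

Lemma part_rank_lt_card I : I \in P -> (part_rank P I < #|P|)%N.
Proof.
move=> IP; apply/proper_card/properP; split; last by exists I; rewrite ?part_notin_below.
by apply/subsetP=> J; rewrite inE => /andP[].
Qed.

Lemma ltn_part_rank I J :
  I \in P -> I \subset below J -> (part_rank P I < part_rank P J)%N.
Proof.
move=> IP IJ; apply/proper_card/properP; split; last first.
  by exists I; rewrite ?part_notin_below // inE IP.
apply/subsetP=> K; rewrite !inE => /andP[-> KI] /=.
exact: subset_trans KI (below_subset (part_neq0 IP) IJ).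
Qed.

Lemma part_rank_inj : {in P &, injective (part_rank P)}.
Proof.
move=> I J IP JP eq_rank; apply: contraTeq isT => IJ.
have := parts_sub_below IP JP IJ.
by case/orP=> [/(ltn_part_rank IP)|/(ltn_part_rank JP)]; rewrite eq_rank ltnn.
Qed.

End IntervalPartition.

Definition cut k a : nat := (a * n %/ k)%N.

Definition block_index k (i : 'I_n) : nat := ((i.+1 * k).-1 %/ n)%N.

Definition block k a : {set 'I_n} := fiber (block_index k) a.

Section Blocks.
Variable k : nat.
Hypothesis k_gt0 : (0 < k)%N.

Lemma leq_cut a (i : 'I_n) : (cut k a <= i)%N = (a <= block_index k i)%N.
Proof.
have n_gt0 := leq_ltn_trans (leq0n i) (ltn_ord i).
rewrite -ltnS ltn_divLR // leq_divRL //.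
by rewrite -[in RHS]ltnS prednK // muln_gt0.
Qed.

Lemma leq_block_index (i j : 'I_n) :
  (i <= j)%N -> (block_index k i <= block_index k j)%N.
Proof.
by move=> ij; rewrite leq_div2r // -!subn1 leq_sub2r // leq_mul2r ltnS ij orbT.
Qed.

Lemma cut_bounds a : (a * (n %/ k) <= cut k a <= a * (n %/ k).+1)%N.
Proof.
rewrite leq_divRL // -mulnA leq_mul2l leq_divM orbT /=.
by rewrite -[leqRHS](mulnK _ k_gt0) leq_div2r // -mulnA leq_mul2l ltnW ?ltn_ceil ?orbT.
Qed.

Lemma blockE a : block k a = ord_itv (cut k a) (cut k a.+1).
Proof.
apply/setP=> i.
by rewrite !inE [X in _ && X]ltnNge !leq_cut // -ltnNge ltnS eqn_leq andbC.
Qed.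

Lemma is_ord_interval_block a : is_ord_interval (block k a).
Proof. by apply/ord_intervalP; rewrite blockE; eexists; eexists. Qed.

Lemma card_block_le a : (#|block k a| <= (n %/ k).+1)%N.
Proof.
rewrite blockE card_ord_itv; apply: leq_trans (leq_sub2r _ (geq_minl _ _)) _.
by rewrite leq_subLR /cut mulSn (leq_trans (leq_divDl _ _ _)) // addn1 addnS addnC.
Qed.

Lemma card_block_ge a : (a < k)%N -> (n %/ k <= #|block k a|)%N.
Proof.
move=> ak; have cut_n : (cut k a.+1 <= n)%N.
  by rewrite -[leqRHS](mulKn _ k_gt0) leq_div2r // leq_mul2r ak orbT.
rewrite blockE card_ord_itv (minn_idPl cut_n) /cut mulSn divnD //.
by rewrite -addnA addnCA addKn leq_addr.
Qed.

Lemma card_setD_saturated_core A : is_ord_interval A ->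
  (#|A :\: saturated_core (block_index k) A| <= 2 * (n %/ k).+1)%N.
Proof.
move=> intA; have [->|A0] := eqVneq A set0; first by rewrite set0D cards0.
have [u [v [uv -> _]]] := ord_interval_neq0P intA A0.
have [u_lt v_lt] : (u < n /\ v.-1 < n)%N by lia.
pose first_block := block k (block_index k (Ordinal u_lt)).
pose last_block := block k (block_index k (Ordinal v_lt)).
apply: (@leq_trans #|first_block :|: last_block|); last first.
  by apply: leq_trans (leq_card_setU _ _) _; rewrite mul2n -addnn leq_add ?card_block_le.
apply/subset_leq_card/subsetP=> i; rewrite in_setD in_setU !in_set.
case/andP=> /subsetPn[j]; rewrite !inE => /eqP ji; rewrite negb_and -ltnNge -leqNgt.
rewrite !eqn_leq; case/orP=> [ju|vj] /andP[ui iv]; apply/orP; [left|right].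
  by rewrite -{1}ji !leq_block_index // ltnW.
by rewrite -{2}ji !leq_block_index //=; lia.
Qed.

End Blocks.

Lemma block_index_factors k t : (0 < k)%N -> (0 < t)%N ->
  factors_through (block_index (k * t)) (block_index k).
Proof.
move=> k_gt0 t_gt0; suff refine i : block_index k i = (block_index (k * t) i %/ t)%N.
  by move=> i j; rewrite !refine => ->.
have leqE a : (a <= block_index k i)%N = (a <= block_index (k * t) i %/ t)%N.
  rewrite leq_divRL // -!leq_cut ?muln_gt0 ?k_gt0 //.
  by rewrite /cut mulnAC divnMr.
by apply/eqP; rewrite eqn_leq -leqE leqnn leqE leqnn.
Qed.

Section Equipartition.
Variable P : {set {set 'I_n}}.
Hypothesis equiP : interval_equipartition P.
Local Notation k := #|P|.

Lemma equipartition_card I : I \in P -> (n %/ k <= #|I| <= (n %/ k).+1)%N.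
Proof.
move=> IP; have [partP _ leS] := equiP.
have k_gt0 : (0 < k)%N by apply/card_gt0P; exists I.
have nE : n = (#|I| + \sum_(J in P :\ I) #|J|)%N.
  by rewrite -(big_setD1 I IP) -(card_partition partP) cardsT card_ord.
have kE : k = #|P :\ I|.+1 by rewrite (cardsD1 I) IP.
have le_sum : (\sum_(J in P :\ I) #|J| <= #|P :\ I| * #|I|.+1)%N.
  by rewrite -sum_nat_const leq_sum // => J /setD1P[_ JP]; exact: leS.
have ge_sum : (#|P :\ I| * #|I|.-1 <= \sum_(J in P :\ I) #|J|)%N.
  rewrite -sum_nat_const leq_sum // => J /setD1P[_ JP].
  by have := leS _ _ IP JP; lia.
apply/andP; split.
  by rewrite -ltnS ltn_divLR // kE mulnC mulSn [X in (X < _)%N]nE; lia.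
have I_gt0 : (0 < #|I|)%N by rewrite card_gt0 (part_neq0 partP).
rewrite -(prednK I_gt0) ltnS leq_divRL // kE mulnC mulSn [X in (_ <= X)%N]nE; lia.
Qed.

Lemma card_below_bounds I : I \in P ->
  (part_rank P I * (n %/ k) <= #|below I| <= part_rank P I * (n %/ k).+1)%N.
Proof.
have [partP intP _] := equiP; move=> IP; rewrite (card_below partP intP IP).
rewrite /part_rank -!sum_nat_const.
by apply/andP; split; apply: leq_sum => J;
  rewrite inE => /andP[/equipartition_card/andP[]].
Qed.

Lemma card_part_block_setD I (B := block k (part_rank P I)) : I \in P ->
  (#|I :\: B| <= 2 * k)%N /\ (#|B :\: I| <= 2 * k)%N.
Proof.
move=> IP; have [partP intP _] := equiP.
have rank_lt := part_rank_lt_card partP IP.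
have k_gt0 : (0 < k)%N by exact: leq_ltn_trans rank_lt.
have [u [v [uv IE belowE]]] := ord_interval_neq0P (intP _ IP) (part_neq0 partP IP).
have := card_below_bounds IP; rewrite belowE card_ord_itv.
have := equipartition_card IP; rewrite [in #|I|]IE card_ord_itv.
have := cut_bounds k_gt0 (part_rank P I); have := cut_bounds k_gt0 (part_rank P I).+1.
rewrite [in I :\: _]IE [in _ :\: I]IE /B blockE // !mulSn !mulnS.
by move=> *; split; apply: leq_trans (card_ord_itvD _ _ _ _) _; lia.
Qed.

Definition part_core l I A : {set 'I_n} :=
  saturated_core (block_index l) (A :&: block k (part_rank P I)).

Lemma part_core_sub l I A :
  part_core l I A \subset A /\ part_core l I A \subset block k (part_rank P I).
Proof. by apply/andP; rewrite -subsetI; exact: saturated_core_sub. Qed.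

Lemma card_setD_part_core l I A :
    (0 < l)%N -> I \in P -> is_ord_interval A -> A \subset I ->
  (#|A :\: part_core l I A| <= 2 * k + 2 * (n %/ l).+1)%N.
Proof.
move=> l_gt0 IP intA AI; set B := block k (part_rank P I).
have k_gt0 : (0 < k)%N by apply/card_gt0P; exists I.
apply: (@leq_trans #|(I :\: B) :|: ((A :&: B) :\: part_core l I A)|).
  apply/subset_leq_card/subsetP=> i; rewrite in_setD => /andP[iNcore iA].
  by rewrite !in_setU !in_setD in_setI iNcore iA (subsetP AI) //= andbT orNb.
apply: leq_trans (leq_card_setU _ _) _; apply: leq_add.
  by case: (card_part_block_setD IP).
apply: (card_setD_saturated_core l_gt0); apply: is_ord_intervalI intA _.
exact: is_ord_interval_block.
Qed.

End Equipartition.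
End OrdIntervals.

Lemma lt0n_of_mulr_natr_gt0 (R : numDomainType) (x : R) N : 0 < x * N%:R -> (0 < N)%N.
Proof. by case: N => //; rewrite mulr0 ltxx. Qed.

Definition large_subinterval (R : realType) n (eps : R) (I A : {set 'I_n}) : Prop :=
  [/\ is_ord_interval A, A \subset I & eps * #|I|%:R <= #|A|%:R].

Lemma irregular_pair_witness (R : realType) n (Y : 'M[R]_n) (eps : R) (I J : {set 'I_n}) :
  ~~ interval_regular_pair eps Y I J ->
  exists A B, [/\ large_subinterval eps I A, large_subinterval eps J B
    & eps < `|density Y A B - density Y I J|].
Proof.
case/forallPn=> A /forallPn[B]; rewrite negb_imply -ltNge.
by case/andP=> /and5P[intA intB AI BJ /andP[cA cB]] irregular; exists A, B.
Qed.

Section Densities.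
Variables (R : realType) (n : nat) (Y : 'M[R]_n).
Hypothesis Y01 : forall i j, 0 <= Y i j <= 1.
Implicit Types (I J A B : {set 'I_n}).

Definition entries (p : 'I_n * 'I_n) : R := Y p.1 p.2.

Lemma density_mean I J : density Y I J = mean entries (setX I J).
Proof.
rewrite /density /mean cardsX natrM pair_big_dep /=; congr (_ / _).
by apply: eq_bigl => p; rewrite inE.
Qed.

Lemma density_subset I J A B : A \subset I -> B \subset J ->
  `|density Y A B - density Y I J| <= missing_ratio R A I + missing_ratio R B J.
Proof.
move=> AI BJ; rewrite !density_mean; apply: le_trans (missing_ratio_setX _ _ _ _ _).
by apply: mean_subset (setXS AI BJ) => p; exact: Y01.
Qed.

Lemma interval_regular_pair_of_ge (eps : R) I J : 2 / 3 <= eps ->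
  I != set0 -> J != set0 -> interval_regular_pair eps Y I J.
Proof.
move=> eps_ge I0 J0; apply: contraT => /irregular_pair_witness[A [B]].
case=> -[_ AI cA] [_ BJ cB]; rewrite ltNge => /negP[].
have missing (X Z : {set 'I_n}) : Z != set0 -> X \subset Z ->
    eps * #|Z|%:R <= #|X|%:R -> missing_ratio R X Z <= 1 - eps.
  move=> Z0 XZ; rewrite (card_missing_ratio R XZ) ler_pM2r ?ltr0n ?card_gt0 //; lra.
apply: le_trans (density_subset AI BJ) _.
by have := missing _ _ I0 AI cA; have := missing _ _ J0 BJ cB; lra.
Qed.

Definition block_index2 k (p : 'I_n * 'I_n) : nat * nat :=
  (block_index k p.1, block_index k p.2).

Definition level_energy k : R := energy (block_index2 k) entries.

Lemma fiber_block_index2 k a b :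
  fiber (block_index2 k) (a, b) = setX (block n k a) (block n k b).
Proof. by apply/setP=> -[i j]; rewrite in_setX !inE. Qed.

Lemma block_index2_factors k t : (0 < k)%N -> (0 < t)%N ->
  factors_through (block_index2 (k * t)) (block_index2 k).
Proof.
move=> k_gt0 t_gt0 p q [eq_row eq_col]; congr (_, _).
  exact: (block_index_factors k_gt0 t_gt0 eq_row).
exact: (block_index_factors k_gt0 t_gt0 eq_col).
Qed.

Lemma level_energy_bounds k : 0 <= level_energy k <= n%:R ^+ 2.
Proof.
have := @energy_bounds _ _ _ (block_index2 k) entries (fun p => Y01 p.1 p.2).
by rewrite card_prod !card_ord natrM.
Qed.

Section EnergyIncrement.
Variables (eps : R) (P : {set {set 'I_n}}) (t : nat).
Hypothesis eps_gt0 : 0 < eps.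
Hypothesis eps_le1 : eps <= 1.
Hypothesis equiP : interval_equipartition P.
Local Notation k := #|P|.
Local Notation s := (n %/ k)%N.
Hypothesis k_gt0 : (0 < k)%N.
Hypothesis t_large : 64 <= eps ^+ 2 * t%:R.
Hypothesis n_large : (k ^ 2 * t <= n)%N.

Lemma refinement_gt0 : (0 < t)%N.
Proof. by apply: (@lt0n_of_mulr_natr_gt0 _ (eps ^+ 2)); apply: lt_le_trans t_large. Qed.

Lemma refined_level_le_part_size : (k * t <= s)%N.
Proof. by rewrite leq_divRL // mulnAC mulnn. Qed.

Lemma part_size_gt0 : (0 < s)%N.
Proof.
by apply: leq_trans refined_level_le_part_size; rewrite muln_gt0 k_gt0 refinement_gt0.
Qed.

Lemma natr_le_eps_sqr_size c d :
  (t * d <= c * s)%N -> d%:R <= c%:R / 64 * eps ^+ 2 * s%:R.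
Proof.
rewrite -(ler_nat R) !natrM => td_le; have eps2_gt0 : 0 < eps ^+ 2 by rewrite exprn_gt0.
have -> : c%:R / 64 * eps ^+ 2 * s%:R = eps ^+ 2 * (c%:R * s%:R) / 64 by ring.
rewrite ler_pdivlMr // mulrC; apply: (@le_trans _ _ (eps ^+ 2 * (t%:R * d%:R))).
  by rewrite mulrA ler_wpM2r.
by rewrite ler_pM2l.
Qed.

Lemma missing_part_block I (B := block n k (part_rank P I)) : I \in P ->
  missing_ratio R (I :&: B) I <= eps / 32 /\ missing_ratio R (I :&: B) B <= eps / 32.
Proof.
move=> IP; have [IB BI] := card_part_block_setD equiP IP.
have small (Z X : {set 'I_n}) : (s <= #|Z|)%N -> (#|Z :\: X| <= 2 * k)%N ->
    missing_ratio R X Z <= eps / 32.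
  move=> Zs ZX; apply: missing_ratio_le; first by rewrite divr_ge0 // ltW.
  have td : (t * #|Z :\: X| <= 2 * s)%N by have := refined_level_le_part_size; nia.
  apply: le_trans (natr_le_eps_sqr_size td) _.
  have eps_sqr : eps ^+ 2 <= eps by rewrite expr2 ler_piMl // ltW.
  apply: (@le_trans _ _ (eps / 32 * s%:R)); first by rewrite ler_wpM2r //; lra.
  by rewrite ler_wpM2l ?ler_nat ?divr_ge0 // ltW.
have [partP intP _] := equiP.
split; apply: small.
- by case/andP: (equipartition_card equiP IP).
- by rewrite setDIr setDv set0U.
- exact: card_block_ge (part_rank_lt_card partP IP).
- by rewrite setDIr setDv setU0.
Qed.

Lemma density_part_block I J : I \in P -> J \in P ->
  `|density Y I J - density Y (block n k (part_rank P I)) (block n k (part_rank P J))|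
    <= eps / 8.
Proof.
move=> IP JP; set KI := block _ _ _; set KJ := block _ _ _.
have [missI missKI] := missing_part_block IP.
have [missJ missKJ] := missing_part_block JP.
have := density_subset (subsetIl I KI) (subsetIl J KJ).
have := density_subset (subsetIr I KI) (subsetIr J KJ).
by rewrite !ler_norml; lra.
Qed.

Lemma card_large_subinterval_ge I A :
  I \in P -> large_subinterval eps I A -> eps * s%:R <= #|A|%:R.
Proof.
move=> IP [_ _]; apply: le_trans; rewrite ler_pM2l // ler_nat.
by case/andP: (equipartition_card equiP IP).
Qed.

Lemma missing_part_core I A : I \in P -> large_subinterval eps I A ->
  missing_ratio R (part_core P (k * t) I A) A <= 3 / 32 * eps.
Proof.
move=> IP A_large; have [intA AI _] := A_large.
have kt_gt0 : (0 < k * t)%N by rewrite muln_gt0 k_gt0 refinement_gt0.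
have td : (t * #|A :\: part_core P (k * t) I A| <= 6 * s)%N.
  have card_diff := card_setD_part_core equiP kt_gt0 IP intA AI.
  apply: leq_trans (leq_mul (leqnn t) card_diff) _; rewrite divnMA.
  have -> : (t * (2 * k + 2 * (s %/ t).+1) =
      2 * (k * t) + (2 * (s %/ t * t) + 2 * t))%N by ring.
  have -> : (6 * s = 2 * s + (2 * s + 2 * s))%N by ring.
  have t_le_s : (t <= s)%N.
    by apply: leq_trans refined_level_le_part_size; rewrite leq_pmull.
  by rewrite !leq_add ?leq_mul2l ?refined_level_le_part_size ?leq_divM.
apply: missing_ratio_le; first by rewrite mulr_ge0 ?divr_ge0 // ltW.
apply: le_trans (natr_le_eps_sqr_size td) _.
have -> : 6 / 64 * eps ^+ 2 * s%:R = 3 / 32 * eps * (eps * s%:R) by field.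
rewrite ler_wpM2l ?mulr_ge0 ?invr_ge0 ?(ltW eps_gt0) //.
exact: card_large_subinterval_ge IP A_large.
Qed.

Lemma card_part_core_ge I A : I \in P -> large_subinterval eps I A ->
  7 / 8 * eps * s%:R <= #|part_core P (k * t) I A|%:R.
Proof.
move=> IP A_large; have [core_sub _] := part_core_sub P (k * t) I A.
rewrite (card_missing_ratio R core_sub) -mulrA.
have ratio_ge : 7 / 8 <= 1 - missing_ratio R (part_core P (k * t) I A) A.
  by have := missing_part_core IP A_large; have := eps_le1; lra.
apply: (@le_trans _ _ (7 / 8 * #|A|%:R)); last by rewrite ler_wpM2r.
by rewrite ler_wpM2l ?divr_ge0 // (card_large_subinterval_ge IP A_large).
Qed.

Lemma irregular_pair_energy_gain I J (v := (part_rank P I, part_rank P J)) :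
    I \in P -> J \in P -> ~~ interval_regular_pair eps Y I J ->
  eps ^+ 4 / 8 * s%:R ^+ 2 <= \sum_(p in fiber (block_index2 k) v)
    (class_mean (block_index2 (k * t)) entries p
       - class_mean (block_index2 k) entries p) ^+ 2.
Proof.
move=> IP JP /irregular_pair_witness[A [B [A_large B_large irregular]]].
have cA := card_part_core_ge IP A_large; have cB := card_part_core_ge JP B_large.
have missA := missing_part_core IP A_large; have missB := missing_part_core JP B_large.
have [A'A A'I] := part_core_sub P (k * t) I A.
have [B'B B'J] := part_core_sub P (k * t) J B.
set A' := part_core _ _ _ A in cA missA A'A A'I.
set B' := part_core _ _ _ B in cB missB B'B B'J.
set KI := block n k _ in A'I; set KJ := block n k _ in B'J.
have far : eps / 2 <= `|density Y A' B' - density Y KI KJ|.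
  have dA := density_subset A'A B'B; have dI := density_part_block IP JP.
  rewrite leNgt; apply/negP=> near; move: irregular; rewrite ltNge => /negP[].
  by move: dA dI near; rewrite ltr_norml !ler_norml; have := eps_gt0; lra.
have vE : fiber (block_index2 k) v = setX KI KJ by exact: fiber_block_index2.
have sub_v : setX A' B' \subset fiber (block_index2 k) v by rewrite vE setXS.
have core_sat : saturated (block_index2 (k * t)) (setX A' B').
  by apply: saturated_setX; apply: saturated_core_saturated.
apply: le_trans (fiber_energy_gain _ sub_v core_sat).
rewrite vE -!density_mean cardsX natrM -(real_normK (num_real (_ - _))).
have size_ge0 : 0 <= 7 / 8 * eps * s%:R by rewrite !mulr_ge0 ?invr_ge0 // ltW.
have eps2_ge0 : 0 <= eps / 2 by rewrite divr_ge0 // ltW.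
apply: (@le_trans _ _ ((7 / 8 * eps * s%:R) ^+ 2 * (eps / 2) ^+ 2)).
  have -> : (7 / 8 * eps * s%:R) ^+ 2 * (eps / 2) ^+ 2 =
    49 / 256 * (eps ^+ 4 * s%:R ^+ 2) by field.
  have -> : eps ^+ 4 / 8 * s%:R ^+ 2 = 1 / 8 * (eps ^+ 4 * s%:R ^+ 2) by field.
  by rewrite ler_wpM2r ?mulr_ge0 ?exprn_ge0 ?(ltW eps_gt0) //; lra.
by apply: ler_pM; rewrite ?sqr_ge0 // -?[leLHS]expr2 ?ler_pM.
Qed.

Lemma irregular_partition_energy_gain : ~ interval_regular_partition eps Y P ->
  eps ^+ 5 / 32 * n%:R ^+ 2 < level_energy (k * t) - level_energy k.
Proof.
move/negP; rewrite /interval_regular_partition -ltNge.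
set bad := [set p in _ | _] => many_bad.
have badP p : p \in bad ->
    [/\ p.1 \in P, p.2 \in P & ~~ interval_regular_pair eps Y p.1 p.2].
  by rewrite !inE -andbA => /and3P[].
pose rank2 (p : {set 'I_n} * {set 'I_n}) := (part_rank P p.1, part_rank P p.2).
have [partP intP _] := equiP.
have rank2_inj : {in bad &, injective rank2}.
  move=> [I J] [I' J'] /badP[/= IP JP _] /badP[/= I'P J'P _] [eqI eqJ].
  by congr (_, _); apply: (part_rank_inj partP intP).
have gain :
    #|bad|%:R * (eps ^+ 4 / 8 * s%:R ^+ 2) <= level_energy (k * t) - level_energy k.
  rewrite energy_refine; last exact: block_index2_factors refinement_gt0.
  apply: le_trans (ler_sum_fibers (block_index2 k) rank2_inj (fun=> sqr_ge0 _)).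
  rewrite mulr_natl -sumr_const; apply: ler_sum => p /badP[IP JP].
  exact: irregular_pair_energy_gain.
apply: lt_le_trans gain.
have s_gt0 := part_size_gt0.
have n_le : n%:R <= 2 * (k%:R * s%:R) :> R.
  by rewrite -!natrM ler_nat; have := ltn_ceil n k_gt0; nia.
apply: (@le_lt_trans _ _ (eps * k%:R ^+ 2 * (eps ^+ 4 / 8 * s%:R ^+ 2))).
  have -> : eps * k%:R ^+ 2 * (eps ^+ 4 / 8 * s%:R ^+ 2) =
      eps ^+ 5 / 32 * (2 * (k%:R * s%:R)) ^+ 2 by field.
  by rewrite ler_wpM2l ?ler_sqr ?nnegrE ?mulr_ge0 ?invr_ge0 ?exprn_ge0 // ltW.
by rewrite ltr_pM2r // !mulr_gt0 ?invr_gt0 ?exprn_gt0 ?ltr0n.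
Qed.

End EnergyIncrement.
End Densities.

Definition regular_level (R : realType) n (eps : R) (Y : 'M[R]_n) k : Prop :=
  forall P : {set {set 'I_n}}, #|P| = k -> interval_equipartition P ->
  interval_regular_partition eps Y P.

Lemma regular_level_of_ge (R : realType) n (eps : R) (Y : 'M[R]_n) k :
  (forall i j, 0 <= Y i j <= 1) -> 2 / 3 <= eps -> regular_level eps Y k.
Proof.
move=> Y01 eps_ge P _ [partP _ _]; rewrite /interval_regular_partition.
set bad := [set p in _ | _]; suff -> : bad = set0.
  by rewrite cards0 mulr_ge0 ?exprn_ge0 //; lra.
apply/eqP/set0Pn=> -[p]; rewrite !inE => /andP[/andP[IP JP] /negP[]].
by apply: interval_regular_pair_of_ge; rewrite ?(part_neq0 partP).
Qed.

Lemma regular_level_of_gt (R : realType) n (eps : R) (Y : 'M[R]_n) k :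
  (n < k)%N -> regular_level eps Y k.
Proof.
by move=> nk P cardP [partP _ _]; rewrite -cardP ltnNge (card_partition_le partP) in nk.
Qed.

Lemma exists_small_increment (R : realDomainType) (u : nat -> R) (N d : R) T :
    (0 < T)%N -> (forall i, 0 <= u i <= N) -> N <= T%:R * d ->
  exists2 i, (i < T)%N & u i.+1 - u i <= d.
Proof.
move=> T_gt0 uN Nd; have [/existsP[i]|/existsPn large] :=
  boolP [exists i : 'I_T, u i.+1 - u i <= d]; first by exists i.
have : T%:R * d < u T - u 0.
  rewrite -telescope_sumr // big_mkord mulr_natl -[T in d *+ T]card_ord -sumr_const.
  apply: ltr_sum => [|i _]; last by rewrite ltNge.
  by apply/hasP; exists (Ordinal T_gt0); rewrite ?mem_index_enum.
by have := uN T; have := uN 0; lra.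
Qed.

Lemma exists_regular_level (R : realType) n (Y : 'M[R]_n) (eps : R) (m t T : nat) :
    (forall i j, 0 <= Y i j <= 1) -> 0 < eps <= 1 -> (0 < m)%N ->
    64 <= eps ^+ 2 * t%:R -> 32 <= eps ^+ 5 * T%:R ->
  exists2 k, (m <= k <= (m * t ^ T) ^ 2)%N & regular_level eps Y k.
Proof.
move=> Y01 /andP[eps_gt0 eps_le1] m_gt0 t_large T_large.
have t_gt0 : (0 < t)%N by exact: refinement_gt0 t_large.
have level_gt0 i : (0 < m * t ^ i)%N by rewrite muln_gt0 m_gt0 expn_gt0 t_gt0.
have level_mono i : (i <= T)%N -> (m * t ^ i <= m * t ^ T)%N.
  by move=> iT; rewrite leq_mul2l leq_pexp2l ?orbT.
have level_bounds i : (i <= T)%N -> (m <= m * t ^ i <= (m * t ^ T) ^ 2)%N.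
  move=> iT; rewrite leq_pmulr ?expn_gt0 ?t_gt0 //=.
  by rewrite (leq_trans (level_mono _ iT)) // -mulnn leq_pmull.
have [n_lt|n_ge] := ltnP n ((m * t ^ T) ^ 2).
  exists ((m * t ^ T) ^ 2)%N; last exact: regular_level_of_gt.
  by have /andP[/leq_trans m_le /m_le->] := level_bounds 0%N (leq0n T); rewrite leqnn.
have T_gt0 : (0 < T)%N.
  by apply: (@lt0n_of_mulr_natr_gt0 _ (eps ^+ 5)); apply: lt_le_trans T_large.
have energy_le : n%:R ^+ 2 <= T%:R * (eps ^+ 5 / 32 * n%:R ^+ 2).
  have -> : T%:R * (eps ^+ 5 / 32 * n%:R ^+ 2) = eps ^+ 5 * T%:R / 32 * n%:R ^+ 2 by ring.
  by rewrite ler_peMl ?sqr_ge0 // ler_pdivlMr // mul1r.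
have [i iT gap] :=
  exists_small_increment T_gt0 (fun i => level_energy_bounds Y01 (m * t ^ i)) energy_le.
exists (m * t ^ i)%N; first by rewrite level_bounds // ltnW.
move=> P cardP equiP; apply: contraT => /negP irregular.
move: gap; rewrite expnSr mulnA leNgt -cardP => /negP[].
apply: irregular_partition_energy_gain => //; rewrite cardP //.
apply: leq_trans n_ge; rewrite -[leqRHS]mulnn.
apply: leq_trans (leq_mul (level_mono i (ltnW iT)) (level_mono i.+1 iT)).
by rewrite -mulnn (expnSr t) !mulnA.
Qed.

Lemma half_le_ln2 (R : realType) : 1 / 2 <= ln 2 :> R.
Proof.
have : ln (1 + - 2^-1) <= - 2^-1 :> R by apply: le_ln1Dx; lra.
have -> : 1 + - 2^-1 = 2^-1 :> R by field.
by rewrite lnV ?posrE //; lra.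
Qed.

Definition regularity_bound (R : realType) (C eps : R) (m : nat) : R :=
  m%:R `^ C * eps `^ (- C * eps ^- 5).

Section RegularityBound.
Variables (R : realType) (C eps : R) (m : nat).
Hypothesis eps_gt0 : 0 < eps.
Hypothesis m_gt0 : (0 < m)%N.

Lemma le_regularity_bound (y : R) : 0 < y ->
  (y <= regularity_bound C eps m) = (ln y <= C * (ln m%:R - eps ^- 5 * ln eps)).
Proof.
move=> y_gt0; have m_pos : 0 < m%:R :> R by rewrite ltr0n.
rewrite -ler_ln ?posrE ?mulr_gt0 ?powR_gt0 // lnM ?posrE ?powR_gt0 // !ln_powR.
by rewrite mulrBr mulrA mulNr mulNr.
Qed.

Lemma ln_div_expr5_le0 : eps <= 1 -> eps ^- 5 * ln eps <= 0.
Proof.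
by move=> eps_le1; rewrite mulr_ge0_le0 ?ln_le0 // invr_ge0 exprn_ge0 // ltW.
Qed.

Lemma ln_div_expr5_le : eps ^- 5 * ln eps <= 1 / 4.
Proof.
have [/ln_div_expr5_le0|eps_gt1] := leP eps 1; first by lra.
rewrite mulrC ler_pdivrMr ?exprn_gt0 //; apply: (@le_trans _ _ (1 / 4 * eps ^+ 2)).
  have : ln eps <= eps - 1.
    by have := @le_ln1Dx _ (eps - 1); rewrite [1 + _]addrC subrK; apply; lra.
  by have := sqr_ge0 (eps - 2); rewrite sqrrB; lra.
by apply: ler_wpM2l; [lra | rewrite ler_eXn2l].
Qed.

Lemma natr_le_regularity_bound :
  2 <= C -> eps <= 1 \/ (1 < m)%N -> m%:R <= regularity_bound C eps m.
Proof.
move=> C_ge2 eps_m; rewrite le_regularity_bound ?ltr0n //.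
have ln_m_ge0 : 0 <= ln m%:R :> R by rewrite ln_ge0 // ler1n.
suff half : eps ^- 5 * ln eps <= ln m%:R / 2.
  apply: (@le_trans _ _ (2 * (ln m%:R - eps ^- 5 * ln eps))); first by lra.
  by rewrite ler_wpM2r //; lra.
case: eps_m => [/ln_div_expr5_le0|m_gt1]; first by lra.
have : ln 2 <= ln m%:R :> R by rewrite ler_ln ?posrE ?ltr0n // ler_nat.
by have := half_le_ln2 R; have := ln_div_expr5_le; lra.
Qed.

(* 858 = 2 * 33 * 13, since t <= eps^-13. *)
Lemma sqr_level_le_regularity_bound (t T : nat) :
    858 <= C -> eps <= 2 / 3 -> (0 < t)%N ->
    t%:R <= 65 * eps ^- 2 -> T%:R <= 33 * eps ^- 5 ->
  ((m * t ^ T) ^ 2)%N%:R <= regularity_bound C eps m.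
Proof.
move=> C_ge eps_le t_gt0; rewrite le_regularity_bound; last first.
  by rewrite ltr0n expn_gt0 muln_gt0 m_gt0 expn_gt0 t_gt0.
have -> : ln eps = - ln eps^-1 by rewrite lnV ?posrE ?opprK.
have : 3 / 2 <= eps^-1 by rewrite -[eps^-1]div1r ler_pdivlMr //; lra.
rewrite -!exprVn; move: eps^-1 => x x_ge t_le T_le.
have ln_x_ge0 : 0 <= ln x by rewrite ln_ge0 //; lra.
have ln_t : ln t%:R <= 13%:R * ln x.
  rewrite mulr_natl -lnXn; last by lra.
  rewrite ler_ln ?posrE ?ltr0n ?exprn_gt0 //; last by lra.
  apply: le_trans t_le _; rewrite (exprD x 11 2) ler_wpM2r ?sqr_ge0 //.
  apply: (@le_trans _ _ ((3 / 2) ^+ 11)); first by rewrite !exprS expr0; lra.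
  by rewrite lerXn2r ?nnegrE //; lra.
have ln_m_ge0 : 0 <= ln m%:R :> R by rewrite ln_ge0 // ler1n.
rewrite natrX natrM natrX lnXn ?mulr_gt0 ?exprn_gt0 ?ltr0n //.
rewrite lnM ?posrE ?exprn_gt0 ?ltr0n // lnXn ?ltr0n // -[ln t%:R *+ T]mulr_natl.
have T_ln_t : T%:R * ln t%:R <= 33 * x ^+ 5 * (13 * ln x).
  by apply: ler_pM => //; rewrite ln_ge0 // ler1n.
apply: (@le_trans _ _ (858 * (ln m%:R - x ^+ 5 * - ln x))); first by lra.
by rewrite ler_wpM2r // mulrN opprK addr_ge0 // mulr_ge0 // exprn_ge0; lra.
Qed.

End RegularityBound.

Lemma exists_natr_mul_ge (R : archiRealFieldType) (x c : R) : 0 < x <= 1 -> 0 <= c ->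
  exists2 N : nat, c <= x * N%:R & N%:R <= (c + 1) * x^-1.
Proof.
move=> /andP[x_gt0 x_le1] c_ge0; have /truncn_itv/andP[trunc_le trunc_gt] : 0 <= c / x.
  by rewrite divr_ge0 // ltW.
exists (Num.truncn (c / x)).+1.
  by rewrite mulrC -ler_pdivrMr // ltW.
by rewrite -natr1 mulrDl mul1r lerD // invf_ge1.
Qed.

Theorem theorem7p3 (R : realType) :
  exists C : R, 0 < C /\
    forall (eps : R) (m : nat), 0 < eps -> (0 < m)%N ->
    (* for eps > 1 and m = 1 the bound M is < 1, so [m, M] is empty *)
    eps <= 1 \/ (1 < m)%N ->
    forall (n : nat) (Y : 'M[R]_n), (forall i j, 0 <= Y i j <= 1) ->
    exists k : nat,
      [/\ (m <= k)%N,
          k%:R <= m%:R `^ C * eps `^ (- C * eps ^- 5)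
        & forall P : {set {set 'I_n}},
            #|P| = k -> interval_equipartition P ->
            interval_regular_partition eps Y P].
Proof.
exists 858; split=> // eps m eps_gt0 m_gt0 eps_m n Y Y01.
have [eps_ge|eps_lt] := leP (2 / 3) eps.
  exists m; split=> //; last exact: regular_level_of_ge.
  by apply: natr_le_regularity_bound; rewrite ?ler_nat.
have eps_le1 : eps <= 1 by lra.
have eps_expr i : 0 < eps ^+ i <= 1 by rewrite exprn_gt0 // exprn_ile1 // ltW.
have [t t_large t_le] := exists_natr_mul_ge (eps_expr 2) (ler0n R 64).
have [T T_large T_le] := exists_natr_mul_ge (eps_expr 5) (ler0n R 32).
have [k /andP[m_le k_le] reg_k] :=
  exists_regular_level Y01 (eps_expr 1%N) m_gt0 t_large T_large.
exists k; split=> //; apply: (@le_trans _ _ ((m * t ^ T) ^ 2)%N%:R).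
  by rewrite ler_nat.
apply: sqr_level_le_regularity_bound => //; [exact: ltW | | lra | lra].
exact: refinement_gt0 t_large.
Qed.
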